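(* If a poset $P$ is L-bounded, then the limit $\pi(P)=\lim_{n\to\infty}\mathrm{La}(n,P)/\binom{n}{\lfloor n/2\rfloor}$ exists and $\pi(P)=e(P)$.
   Context: All posets are finite and nonempty. Let $[n]=\{1,\dots,n\}$; families of subsets of $[n]$ are ordered by inclusion. A poset $(P,\le)$ contains a poset $(P',\le')$ as a (weak) subposet if there is an injection $f:P'\to P$ such that $u\le' v$ implies $f(u)\le f(v)$. A family $\mathcal F\subseteq 2^{[n]}$ is $P$-free if it does not contain $P$ in this sense. $\mathrm{La}(n,P)$ is the largest size of a $P$-free family $\mathcal F\subseteq 2^{[n]}$. $e(P)$ is the maximum integer $k\ge 0$ such that for all integers $n$ and $s$ the family $\binom{[n]}{s}\cup\binom{[n]}{s+1}\cup\cdots\cup\binom{[n]}{s+k-1}$ is $P$-free, where $\binom{[n]}{j}$ is the collection of $j$-element subsets of $[n]$ (empty if $j<0$ or $j>n$). The Lubell function of $\mathcal F\subseteq 2^{[n]}$ is the average over all $n!$ full (maximal) chains $\mathcal C$ of $2^{[n]}$ of $|\mathcal F\cap\mathcal C|$; equivalently $\bar h_n(\mathcal F)=\sum_{F\in\mathcal F}1/\binom{n}{|F|}$. For an integer $m\ge0$, $P$ is $m$-L-bounded if for all $n$, $\bar h_n(\mathcal F)\le e(P)$ for every $P$-free family $\mathcal F$ of subsets of $[n]$ all of whose members have sizes in $[m,n-m]$. $P$ is L-bounded if it is $m$-L-bounded for some integer $m\ge 0$. *)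

(* Defs.v *)
From HB Require Import structures.
From mathcomp Require Import all_boot all_order all_algebra.
From mathcomp Require Import all_classical all_reals all_analysis.
Set Implicit Arguments.
Unset Strict Implicit.
Unset Printing Implicit Defensive.
Import Order.TTheory GRing.Theory Num.Theory.
Import numFieldNormedType.Exports.

Local Open Scope ring_scope.

(* The ground set [n] is represented by 'I_n. *)

Definition contains_poset d (P : finPOrderType d) n (F : {set {set 'I_n}}) : Prop :=
  exists f : P -> {set 'I_n},
    [/\ injective f,
        (forall u : P, f u \in F) &
        (forall u v : P, (u <= v)%O -> f u \subset f v)].

Definition poset_free d (P : finPOrderType d) n (F : {set {set 'I_n}}) : Prop :=
  ~ contains_poset P F.

(* If P is nonempty, the empty family is P-free, so this is a genuine maximum
   and not the default value of an empty \max. *)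
Definition La n d (P : finPOrderType d) : nat :=
  \max_(F : {set {set 'I_n}} | `[< poset_free P F >]) #|F|.

Definition level n (j : int) : {set {set 'I_n}} :=
  [set A : {set 'I_n} | #|A|%:Z == j].

Definition consecutive_levels n (s : int) (k : nat) : {set {set 'I_n}} :=
  (\bigcup_(i < k) level n (s + (i : nat)%:Z))%SET.

Definition levels_free d (P : finPOrderType d) (k : nat) : Prop :=
  forall (n : nat) (s : int), poset_free P (consecutive_levels n s k).

(* The default 0 of xget is never used when P is nonempty, see ePosetP. *)
Definition ePoset d (P : finPOrderType d) : nat :=
  xget 0%N [set k | levels_free P k /\
                    forall j, levels_free P j -> (j <= k)%N]%classic.

Definition set_chain n (C : {set {set 'I_n}}) : bool :=
  [forall A in C, forall B in C, (A \subset B) || (B \subset A)].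

Definition full_chains n : {set {set {set 'I_n}}} :=
  [set C : {set {set 'I_n}} | maxset (@set_chain n) C].

Definition lubell n (F : {set {set 'I_n}}) : rat :=
  (\sum_(C in full_chains n) #|F :&: C|%:R) / #|full_chains n|%:R.

(* The upper bound #|A| <= n - m is written additively because subtraction on
   nat is truncated. *)
Definition mL_bounded (m : nat) d (P : finPOrderType d) : Prop :=
  forall (n : nat) (F : {set {set 'I_n}}),
    poset_free P F ->
    (forall A, A \in F -> (m <= #|A|)%N /\ (#|A| + m <= n)%N) ->
    lubell F <= (ePoset P)%:R.

Definition L_bounded d (P : finPOrderType d) : Prop :=
  exists m : nat, mL_bounded m P.

Definition La_ratio (R : realType) d (P : finPOrderType d) (n : nat) : R :=
  (La n P)%:R / 'C(n, n./2)%:R.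

Lemma levels_free0 d (P : finPOrderType d) : (0 < #|P|)%N -> levels_free P 0.
Proof.
move=> /card_gt0P [x _] n s [f [_ fF _]].
by have := fF x; rewrite /consecutive_levels big_ord0 inE.
Qed.

Lemma levels_free_leq d (P : finPOrderType d) k :
  levels_free P k -> (k <= #|P|)%N.
Proof.
move=> free_k; rewrite leqNgt; apply/negP => ltPk.
apply: (free_k #|P| 0).
pose f (x : P) : {set 'I_#|P|} := [set enum_rank y | y : P & (y <= x)%O].
have memf x y : (enum_rank y \in f x) = (y <= x)%O.
  by rewrite mem_imset ?inE //; exact: enum_rank_inj.
exists f; split.
- move=> x y fxy; apply/eqP; rewrite eq_le.
  by rewrite -!memf -fxy memf lexx fxy memf lexx.
- move=> x.
  have ltfk : (#|f x| < k)%N.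
    apply: leq_ltn_trans ltPk; rewrite -[leqRHS]card_ord; exact: max_card.
  by apply/bigcupP; exists (Ordinal ltfk) => //; rewrite inE add0r.
- move=> u v uv; apply/fintype.subsetP => i.
  by rewrite -(enum_valK i) !memf => /le_trans; apply.
Qed.

Lemma ePosetP d (P : finPOrderType d) : (0 < #|P|)%N ->
  levels_free P (ePoset P) /\
  forall j, levels_free P j -> (j <= ePoset P)%N.
Proof.
move=> P_gt0; rewrite /ePoset; case: xgetP => [k _ [] //|noe].
have ex : exists k, `[< levels_free P k >].
  by exists 0%N; apply/asboolP; exact: levels_free0.
have bd k : `[< levels_free P k >] -> (k <= #|P|)%N.
  by move=> /asboolP; exact: levels_free_leq.
case: (ex_maxnP ex bd) => k /asboolP fk maxk.
by case: (noe k); split=> // j fj; apply: maxk; apply/asboolP.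
Qed.

(* Main.v *)
(** With e = e(P), b the central binomial coefficient and m a witness of
L-boundedness, the ratio La(n, P) / b lies between e - 2 e^3 / (n + 1) and
e + 4 m^2 / (n + 1). Below: e consecutive levels starting at n/2 are P-free,
and level n/2 + i has size at least (1 - 2 i^2 / (n + 1)) b. Above: in a P-free
family, the at most 4 m^2 b / (n + 1) sets that are within m of the top or the
bottom are discarded; the rest has Lubell function at most e, and each set
contributes at least 1 / b to the Lubell function. *)

Require Import Defs.
From mathcomp Require Import all_boot all_order all_algebra.
From mathcomp Require Import all_classical all_reals all_analysis.
From mathcomp Require Import zify ring lra.
Import Order.TTheory GRing.Theory Num.Theory.
Import numFieldNormedType.Exports.
Local Open Scope ring_scope.

(** * Estimates for binomial coefficients *)

Section Combinatorics.
Local Open Scope nat_scope.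
Implicit Types n k : nat.

Lemma leq_bin_half n k : 'C(n, k) <= 'C(n, n./2).
Proof.
suff low j : j <= n./2 -> 'C(n, j) <= 'C(n, n./2).
  have [/low //|lt_nk] := leqP k n./2.
  have [le_kn|/bin_small -> //] := leqP k n.
  rewrite -bin_sub //; apply: low; lia.
move=> le_jn; rewrite -(subKn le_jn).
elim: (n./2 - j) => [|i IHi]; first by rewrite subn0.
apply: leq_trans IHi.
have [le_ni|lt_in] := leqP n./2 i; first by have -> : n./2 - i.+1 = n./2 - i by lia.
(* Below the middle, C(n, r+1) / C(n, r) = (n - r) / (r + 1) is at least 1. *)
set r := n./2 - i.+1; have -> : n./2 - i = r.+1 by lia.
rewrite -(leq_pmul2l (ltn0Sn r)) mul_bin_left leq_mul2r; apply/orP; right; lia.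
Qed.

(** With b the central coefficient, the step from level n/2 + i to the next loses at most 2 (2i + 1)
    b / (n + 1), and the odd numbers 2i + 1 sum to a square. *)
Lemma bin_half_shift n i :
  n.+1 * 'C(n, n./2) <= n.+1 * 'C(n, n./2 + i) + 2 * i ^ 2 * 'C(n, n./2).
Proof.
elim: i => [|i IHi]; first by rewrite addn0 leq_addr.
apply: leq_trans IHi _.
have := mul_bin_left n (n./2 + i); have := leq_bin_half n (n./2 + i).
rewrite addnS.
move: 'C(n, n./2) 'C(n, n./2 + i) 'C(n, (n./2 + i).+1) => b c c' le_cb.
set a := (n./2 + i).+1 => eq_c.
(* By [eq_c], a c' = (n - n/2 - i) c, and this factor is at least a - (2i + 1). *)
have loss : a * c <= a * c' + (2 * i).+1 * c.
  by rewrite eq_c -mulnDl leq_mul2r; apply/orP; right; lia.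
(* Here n + 1 <= 2a is used to scale the difference d = c - c', so the case c <= c' is treated
   apart. *)
have {}loss : n.+1 * c <= n.+1 * c' + 2 * (2 * i).+1 * c.
  have [le_cc'|/ltnW le_c'c] := leqP c c'.
    by apply: leq_trans (leq_addr _ _); rewrite leq_mul2l le_cc' orbT.
  move: loss; have [d cE] : exists d, c = c' + d by exists (c - c'); rewrite subnKC.
  rewrite {1 3}cE !mulnDr !leq_add2l => loss.
  apply: leq_trans (_ : 2 * a * d <= _); last by rewrite -!mulnA leq_mul2l.
  by rewrite leq_mul2r; apply/orP; right; lia.
have bound : 2 * (2 * i).+1 * c <= 2 * (2 * i).+1 * b by rewrite leq_mul2l le_cb orbT.
have -> : 2 * i.+1 ^ 2 = 2 * i ^ 2 + 2 * (2 * i).+1.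
  by rewrite -!mulnn; lia.
rewrite mulnDl; lia.
Qed.

(** Split n + 1 as (n - k) + (k + 1): since (n - k) C(n, k) = (k + 1) C(n, k + 1), each part
    contributes at most k + 1 central coefficients. *)
Lemma bin_fixed_small n k :
  n.+1 * 'C(n, k) <= 2 * k.+1 * 'C(n, n./2).
Proof.
have [le_kn|/bin_small ->] := leqP k n; last by rewrite muln0.
have -> : n.+1 = (n - k) + k.+1 by lia.
rewrite mulnDl -mul_bin_left mul2n -addnn mulnDl.
by rewrite leq_add ?leq_mul2l ?leq_bin_half ?orbT.
Qed.

End Combinatorics.

(** * Full chains and the Lubell function *)

Section FullChains.
Local Open Scope nat_scope.
Variable n : nat.
Implicit Types (A B D X : {set 'I_n}) (C F : {set {set 'I_n}}) (g : 'I_n -> 'I_n).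

Lemma subset_card_between (T : finType) (A B : {set T}) k :
  A \subset B -> #|A| <= k <= #|B| ->
  exists D : {set T}, [/\ A \subset D, D \subset B & #|D| = k].
Proof.
move=> sAB /andP[leAk lekB]; pose s := take (k - #|A|) (enum (B :\: A)%SET).
have s_sub x : x \in s -> x \in (B :\: A)%SET by move/mem_take; rewrite mem_enum.
exists (A :|: [set x in s])%SET; split; first exact: finset.subsetUl.
  rewrite finset.subUset sAB; apply/fintype.subsetP => x.
  by rewrite inE => /s_sub /finset.setDP[].
rewrite cardsU (_ : (A :&: _)%SET = finset.set0) ?cards0 ?subn0; last first.
  apply/finset.setP => x; rewrite !inE; apply/negP => /andP[xA /s_sub].
  by rewrite inE xA.
have uniq_s : uniq s by rewrite take_uniq ?enum_uniq.
rewrite cardsE (card_uniqP uniq_s) size_take_min -cardE cardsD.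
by rewrite (finset.setIidPr sAB); lia.
Qed.

(** Between the largest member of size at most k and the smallest of size at least k there is a
    k-set comparable to all of C; by maximality it already lies in C. *)
Lemma full_chain_level C k :
  C \in full_chains n -> k <= n -> exists2 D, D \in C & #|D| = k.
Proof.
rewrite inE => /maxsetP[chC maxC] le_kn.
have cmp X Y : X \in C -> Y \in C -> (X \subset Y) || (Y \subset X).
  by move=> XC YC; move/forall_inP: chC => /(_ _ XC)/forall_inP/(_ _ YC).
pose lo := [pred X : {set 'I_n} | (X == finset.set0) || (X \in C) && (#|X| <= k)].
pose hi := [pred X : {set 'I_n} | (X == [set: 'I_n]%SET) || (X \in C) && (k <= #|X|)].
have lo0 : lo finset.set0 by rewrite /= eqxx.
have hiT : hi [set: 'I_n]%SET by rewrite /= eqxx.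
case: (@arg_maxnP _ finset.set0 lo (fun X => #|X|) lo0) => A loA maxA.
case: (@arg_minnP _ [set: 'I_n]%SET hi (fun X => #|X|) hiT) => B hiB minB.
have leAk : #|A| <= k by case/orP: loA => [/eqP->|/andP[]//]; rewrite cards0.
have lekB : k <= #|B|.
  by case/orP: hiB => [/eqP->|/andP[]//]; rewrite cardsT card_ord.
have subA X : X \in C -> #|X| <= k -> X \subset A.
  move=> XC leXk; have leXA : #|X| <= #|A| by apply: maxA; rewrite /= XC leXk orbT.
  case/orP: loA => [/eqP A0|/andP[AC _]].
    by move: leXA; rewrite A0 cards0 leqn0 cards_eq0 => /eqP->.
  case/orP: (cmp _ _ XC AC) => // sAX.
  by move: (eqEcard A X); rewrite sAX leXA => /eqP->.
have subB X : X \in C -> k <= #|X| -> B \subset X.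
  move=> XC lekX; have leBX : #|B| <= #|X| by apply: minB; rewrite /= XC lekX orbT.
  case/orP: hiB => [/eqP BT|/andP[BC _]].
    move: (eqEcard X B) leBX; rewrite BT finset.subsetT => + leBX.
    by rewrite leBX => /eqP->.
  case/orP: (cmp _ _ XC BC) => // sXB.
  by move: (eqEcard X B); rewrite sXB leBX => /eqP->.
have sAB : A \subset B.
  case/orP: loA => [/eqP->|/andP[AC _]]; first exact: finset.sub0set.
  case/orP: (hiB) => [/eqP->|/andP[BC _]]; first exact: finset.subsetT.
  case/orP: (cmp _ _ AC BC) => // sBA.
  by move: (eqEcard B A); rewrite sBA (leq_trans leAk lekB) => /eqP->.
have [|D [sAD sDB Dk]] := @subset_card_between _ _ _ k sAB; first by rewrite leAk.
have cmpD X : X \in C -> (X \subset D) || (D \subset X).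
  move=> XC; have [leXk|/ltnW lekX] := leqP #|X| k.
    by rewrite (fintype.subset_trans (subA _ XC leXk) sAD).
  by rewrite (fintype.subset_trans sDB (subB _ XC lekX)) orbT.
exists D => //; rewrite -(maxC (D |: C)%SET) ?finset.subsetUr ?finset.setU11 //.
apply/forall_inP => X /finset.setU1P[->|XC]; apply/forall_inP => Y /finset.setU1P[->|YC].
- by rewrite fintype.subxx.
- by rewrite orbC cmpD.
- by rewrite cmpD.
- exact: cmp.
Qed.

(** List each set followed by its complement and match the two lists position by position. *)
Lemma exists_bij_imset A B :
  #|A| = #|B| -> exists2 g, injective g & g @: A = B.
Proof.
move=> eqAB; pose s := enum A ++ enum (~: A)%SET; pose t := enum B ++ enum (~: B)%SET.
have size_s : size s = n by rewrite size_cat -!cardE cardsC card_ord.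
have size_t : size t = n by rewrite size_cat -!cardE cardsC card_ord.
have uniq_t : uniq t.
  rewrite cat_uniq !enum_uniq andbT /=; apply/hasPn => x.
  by rewrite !mem_enum inE.
have mem_s x : x \in s by rewrite mem_cat !mem_enum inE orbN.
have lt_s x : index x s < size t by rewrite size_t -[X in _ < X]size_s index_mem.
pose g x := nth x t (index x s).
have g_inj : injective g.
  move=> x y; rewrite /g (set_nth_default x y) // => /eqP.
  by rewrite nth_uniq // => /eqP; apply: index_inj.
exists g => //; apply/eqP; rewrite eqEcard card_imset // eqAB leqnn andbT.
apply/fintype.subsetP => _ /imsetP[x xA ->].
have lt_x : index x s < #|B|.
  rewrite -eqAB [#|A|]cardE /s index_cat mem_enum xA index_mem.
  by rewrite mem_enum.
by rewrite /g nth_cat -cardE lt_x -[_ \in B]mem_enum mem_nth // -cardE.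
Qed.

Lemma set_chain_imset g C : set_chain C -> set_chain [set g @: X | X : {set 'I_n} in C].
Proof.
move=> /forall_inP chC; apply/forall_inP => _ /imsetP[X XC ->].
apply/forall_inP => _ /imsetP[Y YC ->].
by case/orP: (forall_inP (chC _ XC) _ YC) => /(imsetS g) ->; rewrite ?orbT.
Qed.

(** The inverse [h] of g pulls a chain above the image of C back to a chain above C, which must
    equal C. *)
Lemma full_chains_imset g C : injective g ->
  C \in full_chains n -> [set g @: X | X : {set 'I_n} in C] \in full_chains n.
Proof.
move=> g_inj; rewrite !inE => /maxsetP[chC maxC].
set h := invF g_inj.
have imK (f f' : 'I_n -> 'I_n) C' : cancel f f' ->
    [set f' @: X | X : {set 'I_n} in [set f @: X | X : {set 'I_n} in C']] = C'.
  move=> fK; rewrite -imset_comp -[RHS]imset_id; apply: eq_imset => X /=.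
  by rewrite -imset_comp -[RHS]imset_id; apply: eq_imset => x; apply: fK.
apply/maxsetP; split=> [|D chD sCD]; first exact: set_chain_imset.
have hDC : [set h @: X | X : {set 'I_n} in D] = C.
  apply: maxC; first exact: set_chain_imset.
  rewrite -(imK g h C); first exact: imsetS.
  exact: invF_f.
by rewrite -hDC imK //; exact: f_invF.
Qed.

Definition chains_through A := #|[set C in full_chains n | A \in C]|.

(** A permutation taking A to B acts injectively on full chains. By symmetry the count depends on
    the size of A only. *)
Lemma leq_chains_through A B :
  #|A| = #|B| -> chains_through A <= chains_through B.
Proof.
case/exists_bij_imset=> g g_inj <-.
have gg_inj : injective (fun C => [set g @: X | X : {set 'I_n} in C]).
  by apply: imset_inj; apply: imset_inj.
rewrite /chains_through -(card_imset _ gg_inj); apply: subset_leq_card.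
apply/fintype.subsetP => _ /imsetP[C + ->]; rewrite inE => /andP[fullC AC].
by rewrite inE full_chains_imset //= imset_f.
Qed.

Lemma sum_chains_through F :
  \sum_(A in F) chains_through A = \sum_(C in full_chains n) #|F :&: C|%SET.
Proof.
rewrite /chains_through.
under eq_bigr do rewrite -sum1_card.
under [RHS]eq_bigr do rewrite -sum1_card.
rewrite (exchange_big_dep (mem (full_chains n))) /=; last first.
  by move=> A C _; rewrite inE => /andP[].
by apply: eq_bigr => C fullC; apply: eq_bigl => A; rewrite finset.in_setI [X in _ && X]finset.in_set fullC.
Qed.

(* Only the LYM lower bound is needed, so it suffices that the k-subsets all
   lie on equally many full chains and that every full chain meets level k. *)
Lemma leq_full_chains_through A :
  #|full_chains n| <= 'C(n, #|A|) * chains_through A.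
Proof.
have le_An : #|A| <= n by rewrite -[leqRHS]card_ord max_card.
set L : {set {set 'I_n}} := [set B : {set 'I_n} | #|B| == #|A|].
have <- : #|L| = 'C(n, #|A|) by rewrite card_draws card_ord.
rewrite -sum_nat_const; apply: (@leq_trans (\sum_(B in L) chains_through B)).
  rewrite sum_chains_through -sum1_card; apply: leq_sum => C fullC.
  have [D DC Dk] := full_chain_level _ _ fullC le_An.
  by apply/card_gt0P; exists D; rewrite !inE Dk eqxx.
by apply: leq_sum => B; rewrite inE => /eqP/leq_chains_through.
Qed.

Lemma full_chains_gt0 : 0 < #|full_chains n|.
Proof.
have ch0 : set_chain (finset.set0 : {set {set 'I_n}}).
  by apply/forall_inP => A; rewrite inE.
have [C maxC _] := maxset_exists ch0.
by apply/card_gt0P; exists C; rewrite inE.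
Qed.

(** Double counting turns the numerator of [lubell F] into a sum of [chains_through A], each at
    least a 1/b share of all full chains. *)
Lemma lubell_leq F k : (lubell F <= k%:R)%R -> #|F| <= k * 'C(n, n./2).
Proof.
rewrite /lubell -natr_sum ler_pdivrMr ?ltr0n ?full_chains_gt0 //.
rewrite -natrM ler_nat -sum_chains_through => le_sum.
rewrite -(leq_pmul2r full_chains_gt0) mulnAC.
apply: leq_trans (leq_mul le_sum (leqnn 'C(n, n./2))).
rewrite -sum_nat_const big_distrl; apply: leq_sum => A _ /=.
rewrite mulnC; apply: leq_trans (leq_full_chains_through A) _.
by rewrite leq_mul2r leq_bin_half orbT.
Qed.

End FullChains.

(** * Upper and lower bounds on La(n, P) *)

Section Bounds.
Local Open Scope nat_scope.
Variables (d : Order.disp_t) (P : finPOrderType d).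

Lemma poset_free_subset n (F G : {set {set 'I_n}}) :
  F \subset G -> poset_free P G -> poset_free P F.
Proof.
move=> /fintype.subsetP sFG freeG [f [f_inj fF f_homo]]; apply: freeG.
by exists f; split=> // u; apply: sFG.
Qed.

(** Level j costs 2 (j + 1) by [bin_fixed_small]; over j < m this adds up to m (m + 1) <= 2 m^2. *)
Lemma card_small_sets n m :
  n.+1 * #|[set A : {set 'I_n} | #|A| < m]| <= 2 * m ^ 2 * 'C(n, n./2).
Proof.
elim: m => [|m IHm]; first by rewrite (_ : finset _ = finset.set0) ?cards0 ?muln0.
set S := finset (fun A : {set 'I_n} => #|A| < m) in IHm *.
set L := [set A : {set 'I_n} | #|A| == m].
have cardL : #|L| = 'C(n, m) by rewrite card_draws card_ord.
rewrite (_ : finset _ = (S :|: L)%SET); last first.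
  by apply/finset.setP => A; rewrite !inE ltnS leq_eqVlt orbC.
have := bin_fixed_small n m; rewrite -cardL => le_L.
have [le_U _] := leq_card_setU S L.
apply: leq_trans (leq_mul (leqnn n.+1) le_U) _.
rewrite mulnDr; apply: leq_trans (leq_add IHm le_L) _.
by rewrite -mulnDl leq_mul2r; apply/orP; right; rewrite -!mulnn; lia.
Qed.

Lemma La_upper m n : mL_bounded m P ->
  n.+1 * La n P <= (n.+1 * ePoset P + 4 * m ^ 2) * 'C(n, n./2).
Proof.
move=> bounded; rewrite /La; elim/big_ind: _ => [|x y|F /asboolP freeF].
- by rewrite muln0.
- by move=> leX leY; rewrite /maxn; case: ifP.
(* S holds the sets too small for [bounded], S' their complements, which are the sets too large.
   Each accounts for 2 m^2 of the constant 4 m^2. *)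
set S := [set A : {set 'I_n} | #|A| < m].
set S' := [set ~: A | A : {set 'I_n} in S]%SET.
set G := [set A in F | (m <= #|A|) && (#|A| + m <= n)].
have leG : #|G| <= ePoset P * 'C(n, n./2).
  apply/lubell_leq/bounded => [|A]; last by rewrite inE => /and3P[].
  apply: poset_free_subset freeF; apply/fintype.subsetP => A.
  by rewrite inE => /andP[].
have leS' : #|S'| <= #|S| by exact: leq_imset_card.
have sF : F \subset (G :|: (S :|: S'))%SET.
  apply/fintype.subsetP => A AF; rewrite !inE AF /=.
  have [//|le_mA /=] := ltnP #|A| m.
  have [//|lt_n /=] := leqP (#|A| + m) n.
  apply/imsetP; exists (~: A)%SET; last by rewrite finset.setCK.
  by rewrite inE; have := cardsC A; rewrite card_ord; lia.
have leF : #|F| <= #|G| + (#|S| + #|S|).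
  apply: leq_trans (subset_leq_card sF) _.
  apply: leq_trans (leq_card_setU _ _) _; rewrite leq_add2l.
  by apply: leq_trans (leq_card_setU _ _) _; rewrite leq_add2l.
apply: leq_trans (leq_mul (leqnn n.+1) leF) _.
rewrite !mulnDr mulnDl leq_add -?mulnA ?leq_mul2l ?leG ?orbT //.
by have := card_small_sets n m; rewrite -/S; lia.
Qed.

Lemma card_consecutive_levels n h k :
  #|consecutive_levels n h%:Z k| = \sum_(i < k) 'C(n, h + i).
Proof.
rewrite /consecutive_levels; elim: k => [|k IHk].
  by rewrite !big_ord0 cards0.
rewrite !big_ord_recr /= -IHk cardsU -PoszD.
have -> : level n (h + k)%:Z = [set A : {set 'I_n} | #|A| == h + k].
  by apply/finset.setP => A; rewrite !inE eqz_nat.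
rewrite card_draws card_ord (_ : _ :&: _ = finset.set0)%SET ?cards0 ?subn0 //.
apply/finset.setP => A; rewrite !inE; apply/negP => /andP[/bigcupP[i _]].
by rewrite inE -PoszD eqz_nat => /eqP-> /eqP; have := ltn_ord i; lia.
Qed.

Lemma La_lower n k : levels_free P k ->
  n.+1 * k * 'C(n, n./2) <= n.+1 * La n P + 2 * k ^ 3 * 'C(n, n./2).
Proof.
move=> free; set b := 'C(n, n./2).
have leLa : \sum_(i < k) 'C(n, n./2 + i) <= La n P.
  rewrite -card_consecutive_levels; apply: leq_bigmax_cond; apply/asboolP.
  exact: free.
(* Bounding i^2 by k^2 in each of the k levels produces the k^3. *)
have : \sum_(i < k) n.+1 * b <= \sum_(i < k) (n.+1 * 'C(n, n./2 + i) + 2 * k ^ 2 * b).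
  apply: leq_sum => i _; apply: leq_trans (bin_half_shift n i) _.
  by rewrite leq_add2l leq_mul2r leq_mul2l leq_exp2r // (ltnW (ltn_ord i)) !orbT.
rewrite [X in _ <= X -> _]big_split /= !big_const_ord !iter_addn_0 -big_distrr /=.
rewrite -[n.+1 * k * b]mulnAC => /leq_trans; apply; apply: leq_add.
  by rewrite leq_mul2l leLa orbT.
by rewrite (expnSr k 2) mulnA mulnAC.
Qed.

End Bounds.

(** * Passage to the limit *)

Theorem corollary3p4 (R : realType) (d : Order.disp_t) (P : finPOrderType d)
    (P_nonempty : (0 < #|P|)%N) (P_Lbounded : L_bounded P) :
  cvgn (La_ratio R P) /\ limn (La_ratio R P) = (ePoset P)%:R.
Proof.
have [m bounded] := P_Lbounded.
have [free _] := ePosetP P_nonempty.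
set e := ePoset P in free *.
suff lim_e : (La_ratio R P x @[x --> \oo] --> (e%:R : R))%classic.
  split; last exact: cvg_lim.
  by apply/cvg_ex; exists e%:R.
(* [harmonic n] is 1 / (n + 1), the order of both error terms. *)
have lim_err (c : R) : (e%:R + c * harmonic n @[n --> \oo] --> (e%:R : R))%classic.
  rewrite -[X in (_ --> X)%classic]addr0 -[X in (_ --> _ + X)%classic](mulr0 c).
  by apply: cvgD; [exact: cvg_cst | apply: cvgMr; exact: cvg_harmonic].
apply: squeeze_cvgr (lim_err (- (2 * e ^ 3)%N%:R)) (lim_err (4 * m ^ 2)%N%:R).
apply: nearW => n; rewrite /La_ratio /harmonic /=.
have b_gt0 : (0 : R) < 'C(n, n./2)%:R.
  by rewrite ltr0n bin_gt0 leq_half_double; lia.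
have n_gt0 : (0 : R) < n.+1%:R by rewrite ltr0n.
have := La_lower _ P n e free; have := La_upper _ P m n bounded.
rewrite -!(ler_nat R) !(natrD, natrM) -/e => up low.
(* With N = n + 1, this brings both ratio bounds to the denominator-free form of [La_lower] and
   [La_upper]. *)
have clear_denom (x c b N : R) : N != 0 -> N * ((x + c * N^-1) * b) = (N * x + c) * b.
  by move=> N0; field.
apply/andP; split.
  by rewrite ler_pdivlMr // -(ler_pM2l n_gt0) clear_denom ?gt_eqF //; move: low; lra.
by rewrite ler_pdivrMr // -(ler_pM2l n_gt0) clear_denom ?gt_eqF //; move: up; lra.
Qed.
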